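(* Let $n\ge1$, and let $\mathcal H$ be the set of real-valued invariant harmonic functions $h$ on $\mathbb B^n$ with $|h|\le 1$ on $\mathbb B^n$. For $z\in\mathbb B^n$ and a unit vector $l\in\partial\mathbb B^n$, let $\mathcal C(z,l)=\sup_{h\in\mathcal H}|\nabla h(z)\cdot l|$ be the smallest constant for which $|\nabla h(z)\cdot l|\le\mathcal C(z,l)$ for all $h\in\mathcal H$, and let $\mathcal C(z)=\sup_{h\in\mathcal H}\|\nabla h(z)\|$ be the smallest constant for which $\|\nabla h(z)\|\le \mathcal C(z)$ for all $h\in\mathcal H$. Then for every $z\in\mathbb B^n\setminus\{0\}$, $$\sup_{l\in\partial\mathbb B^n}\mathcal C(z,l)=\mathcal C\left(z,\frac{z}{\|z\|}\right)=\mathcal C(z).$$ That is, the sharp constants for the gradient and for the radial derivative coincide.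
   Context: $\mathbb B^n=\{z\in\mathbb C^n:\|z\|<1\}$ with Euclidean norm $\|\cdot\|$, and $\partial\mathbb B^n$ is the unit sphere. A (twice continuously differentiable) function $f$ on $\mathbb B^n$ is called invariant harmonic if $\Delta_B f\equiv 0$ on $\mathbb B^n$, where $$\Delta_B f(z)=4(1-\|z\|^2)\sum_{i,j=1}^n(\delta_{ij}-z_i\overline z_j)\frac{\partial^2 f}{\partial z_i\partial\overline z_j}(z)$$ ($\delta_{ij}$ is the Kronecker delta). With $z_j=x_j+\sqrt{-1}\,y_j$, $\nabla h=(\partial h/\partial x_1,\partial h/\partial y_1,\dots,\partial h/\partial x_n,\partial h/\partial y_n)$ is the Euclidean gradient on $\mathbb C^n\cong\mathbb R^{2n}$, $\|\nabla h\|$ its Euclidean norm, and $\nabla h\cdot l$ is the real dot product with $l$ viewed as the real vector $(\mathrm{Re}\,l_1,\mathrm{Im}\,l_1,\dots,\mathrm{Re}\,l_n,\mathrm{Im}\,l_n)$. *)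

(* Defs.v *)
From HB Require Import structures.
From mathcomp Require Import all_boot all_order all_algebra.
From mathcomp Require Import complex.
From mathcomp Require Import all_classical all_reals all_analysis.
Import Order.TTheory GRing.Theory Num.Theory numFieldNormedType.Exports.

Set Implicit Arguments.
Unset Strict Implicit.
Unset Printing Implicit Defensive.

Local Open Scope classical_set_scope.
Local Open Scope ring_scope.
Local Open Scope complex_scope.

(* C^n is represented by its underlying real normed space R^n x R^n: the pair
   (x, y) stands for z = x + iy.  The norm that the library puts on this
   product is the max norm; it is used only for its topology and for
   differentiability, and the Euclidean norm is [enorm] below. *)
Definition Cn (R : realType) (n : nat) : normedModType R :=
  ('rV[R]_n * 'rV[R]_n)%type.

Section ComplexSpace.
Variables (R : realType) (n : nat).
Implicit Types (z l : Cn R n) (j : 'I_n).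

Definition zcoord z j : R[i] := z.1 0 j +i* z.2 0 j.

Definition rdot z l : R :=
  \sum_(j < n) (z.1 0 j * l.1 0 j + z.2 0 j * l.2 0 j).

Definition enorm z : R := Num.sqrt (rdot z z).

Definition unit_ball : set (Cn R n) := [set z | enorm z < 1].
Definition unit_sphere : set (Cn R n) := [set l | enorm l = 1].

(* Directions of the coordinates x_j and y_j. *)
Definition xdir j : Cn R n := (delta_mx 0 j, 0).
Definition ydir j : Cn R n := (0, delta_mx 0 j).

Definition grad (h : Cn R n -> R) z : Cn R n :=
  (\row_j 'D_(xdir j) h z, \row_j 'D_(ydir j) h z).

(* f is of class C^k on D, which is meant to be open: f is Frechet
   differentiable on D and all its directional derivatives are C^(k-1). *)
Fixpoint class_C (k : nat) (D : set (Cn R n)) (f : Cn R n -> R) : Prop :=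
  match k with
  | 0%N => forall z, D z -> {for z, continuous f}
  | k'.+1 => (forall z, D z -> differentiable f z) /\
             (forall v : Cn R n, class_C k' D ('D_v f))
  end.

(* Real directional derivative of a complex-valued function. *)
Definition cderive (v : Cn R n) (g : Cn R n -> R[i]) z : R[i] :=
  'D_v (fun w => complex.Re (g w)) z +i* 'D_v (fun w => complex.Im (g w)) z.

(* Wirtinger derivatives: d/dz_j = (d/dx_j - i d/dy_j) / 2 and
   d/d(conj z_j) = (d/dx_j + i d/dy_j) / 2. *)
Definition dz j (g : Cn R n -> R[i]) z : R[i] :=
  (cderive (xdir j) g z - (0 +i* 1) * cderive (ydir j) g z) / 2%:R.
Definition dzbar j (g : Cn R n -> R[i]) z : R[i] :=
  (cderive (xdir j) g z + (0 +i* 1) * cderive (ydir j) g z) / 2%:R.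

Definition laplaceB (g : Cn R n -> R[i]) z : R[i] :=
  4%:R * (1 - enorm z ^+ 2)%:C *
  \sum_(i < n) \sum_(j < n)
    ((i == j)%:R - zcoord z i * conjc (zcoord z j)) * dz i (dzbar j g) z.

(* Functions are total on C^n, but only their values on the ball matter. *)
Definition invariant_harmonic (h : Cn R n -> R) : Prop :=
  class_C 2 unit_ball h /\
  forall z, unit_ball z -> laplaceB (fun w => (h w)%:C) z = 0.

Definition bounded_inv_harmonic : set (Cn R n -> R) :=
  [set h | invariant_harmonic h /\ forall z, unit_ball z -> `|h z| <= 1].

(* Sharp constants, as suprema in the extended reals. *)
Definition sharp_dir z l : \bar R :=
  ereal_sup [set (`|rdot (grad h z) l|)%:E | h in bounded_inv_harmonic].

Definition sharp_grad z : \bar R :=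
  ereal_sup [set (enorm (grad h z))%:E | h in bounded_inv_harmonic].

End ComplexSpace.

Arguments unit_ball {R n}.
Arguments unit_sphere {R n}.

(* Main.v *)
(** The group of holomorphic automorphisms of the ball fixing [z] acts
    transitively on the spheres of the Bergman metric in the tangent space at
    [z], and composition with an automorphism preserves bounded invariant
    harmonic functions.  Hence [sharp_dir z l] depends on [l] only through its
    Bergman length, which among Euclidean unit vectors is largest in the radial
    direction.

    Transitivity is obtained from one explicit map.  In homogeneous coordinates
    [(1, x)], a Hermitian form of signature [(n, 1)] defines the ball.  Given two
    vectors of the same length orthogonal to [(1, z)], the quasi-reflection in
    their difference [(b, p)] carries one to the other; it fixes [(1, z)] and
    acts on the ball by a fractional linear map. *)

Require Import Defs.
From HB Require Import structures.
From mathcomp Require Import all_boot all_order all_algebra.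
From mathcomp Require Import complex ring.
From mathcomp Require Import all_classical all_reals all_analysis.
Import Order.TTheory GRing.Theory Num.Theory numFieldNormedType.Exports.

Set Implicit Arguments.
Unset Strict Implicit.
Unset Printing Implicit Defensive.

Local Open Scope classical_set_scope.
Local Open Scope ring_scope.
Local Open Scope complex_scope.

(** * Functions of class C^k *)

(** Differentiability at a point depends only on the germ there. This is used to transfer regularity
    along identities that hold only on an open set. *)
Lemma near_eq_differentiable (K : numFieldType) (V W : normedModType K)
    (f g : V -> W) (x : V) :
  (\near x, f x = g x) -> differentiable f x -> differentiable g x.
Proof.
move=> fg df.
(* The first-order expansion of [f] is also one for [g]; uniqueness of the differential then
   identifies ['d g x] with ['d f x]. *)
have gE : g \o shift x = cst (g x) + 'd f x +o_ (0 : V) id.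
  apply/eqaddoP => _/posnumP[e].
  have /eqaddoP/(_ _ (gt0 e)) fo := diff_locally df.
  have fg' : \forall h \near (0 : V), f (h + x) = g (h + x).
    by move: fg; rewrite (near_shift 0); apply: filterS => h /=; rewrite subr0.
  apply: filterS2 fo fg' => h /=.
  by rewrite !fctE /= => + <-; rewrite (nbhs_singleton fg).
have dfc : continuous ('d f x) by exact: diff_continuous.
have dgE := diff_unique dfc gE.
by apply/diff_locallyP; rewrite dgE.
Qed.

(** * Real coordinates and the chain rule on C^n *)

Section Smoothness.
Variables (R : realType) (n : nat).
Notation E := (Cn R n).


(** The coordinates are made linear forms so that the general facts on differentials of continuous
    linear maps apply to them. *)
Let xc (j : 'I_n) (w : E) : R := w.1 0 j.
Let yc (j : 'I_n) (w : E) : R := w.2 0 j.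

Let xc_linear j : linear (xc j).
Proof. by move=> a u v; rewrite /xc !mxE. Qed.
Let yc_linear j : linear (yc j).
Proof. by move=> a u v; rewrite /yc !mxE. Qed.

HB.instance Definition _ j := GRing.isLinear.Build R E R _ (xc j) (xc_linear j).
HB.instance Definition _ j := GRing.isLinear.Build R E R _ (yc j) (yc_linear j).

Let xc_continuous j : continuous (xc j).
Proof.
move=> w; apply: (@continuous_comp _ _ _ (fst : E -> 'rV[R]_n)
   (fun N : 'rV[R]_n => N 0 j)); first exact: cvg_fst.
exact: coord_continuous.
Qed.
Let yc_continuous j : continuous (yc j).
Proof.
move=> w; apply: (@continuous_comp _ _ _ (snd : E -> 'rV[R]_n)
   (fun N : 'rV[R]_n => N 0 j)); first exact: cvg_snd.
exact: coord_continuous.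
Qed.

Lemma differentiable_xcoord j (x : E) :
  differentiable (fun w : E => w.1 0 j : R) x.
Proof. exact: (linear_differentiable x (@xc_continuous j)). Qed.

Lemma differentiable_ycoord j (x : E) :
  differentiable (fun w : E => w.2 0 j : R) x.
Proof. exact: (linear_differentiable x (@yc_continuous j)). Qed.

Lemma derive_xcoord j (v x : E) : 'D_v (fun w : E => w.1 0 j : R) x = v.1 0 j.
Proof.
rewrite deriveE; last exact: differentiable_xcoord.
by rewrite (diff_lin _ (@xc_continuous j)).
Qed.

Lemma derive_ycoord j (v x : E) : 'D_v (fun w : E => w.2 0 j : R) x = v.2 0 j.
Proof.
rewrite deriveE; last exact: differentiable_ycoord.
by rewrite (diff_lin _ (@yc_continuous j)).
Qed.

Lemma Cn_basis (v : E) :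
  v = \sum_(j < n) (v.1 0 j *: xdir R j + v.2 0 j *: ydir R j).
Proof.
apply/eqP; rewrite -pair_eqE /=.
have fstE : forall F : 'I_n -> E, (\sum_j F j).1 = \sum_j (F j).1.
  by move=> F; exact: (big_morph fst).
have sndE : forall F : 'I_n -> E, (\sum_j F j).2 = \sum_j (F j).2.
  by move=> F; exact: (big_morph snd).
rewrite fstE sndE; apply/andP; split; apply/eqP; rewrite [LHS]row_sum_delta;
  by apply: eq_bigr => j _ /=; rewrite scaler0 ?addr0 ?add0r.
Qed.

Lemma derive_basis (f : E -> R) (v x : E) : differentiable f x ->
  'D_v f x = \sum_(j < n)
    (v.1 0 j * 'D_(xdir R j) f x + v.2 0 j * 'D_(ydir R j) f x).
Proof.
move=> df; rewrite deriveE // {1}(Cn_basis v) linear_sum; apply: eq_bigr => j _.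
by rewrite linearD !linearZ !deriveE.
Qed.

Lemma differentiable_to_Cn (phi : E -> E) (x : E) :
  (forall j, differentiable (fun w => (phi w).1 0 j : R) x) ->
  (forall j, differentiable (fun w => (phi w).2 0 j : R) x) ->
  differentiable phi x.
Proof.
move=> d1 d2.
have drow (p : E -> 'rV[R]_n) :
    (forall j, differentiable (fun w => p w 0 j : R) x) ->
    differentiable p x.
  move=> dp; have -> : p = \sum_(j < n) (fun w => p w 0 j *: delta_mx 0 j).
    by apply/funext => w; rewrite fct_sumE [LHS]row_sum_delta.
  by apply: differentiable_sum => j; apply: differentiableZl.
have -> : phi = (fun w => ((phi w).1, (phi w).2)).
  by apply/funext => w; case: (phi w).
by apply: differentiable_pair; exact: drow.
Qed.

Lemma derive_comp (f : E -> R) (phi : E -> E) (v x : E) :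
  (forall j, differentiable (fun w => (phi w).1 0 j : R) x) ->
  (forall j, differentiable (fun w => (phi w).2 0 j : R) x) ->
  differentiable f (phi x) ->
  'D_v (f \o phi) x = \sum_(j < n)
    ('D_v (fun w => (phi w).1 0 j : R) x * 'D_(xdir R j) f (phi x)
     + 'D_v (fun w => (phi w).2 0 j : R) x * 'D_(ydir R j) f (phi x)).
Proof.
move=> d1 d2 df; have dphi := differentiable_to_Cn d1 d2.
(* A continuous linear form commutes with the differential. Applied to the coordinates, this
   identifies the entries of ['d phi x v] with the derivatives of the entries of [phi]. *)
have dlin (L : {linear E -> R}) : continuous L ->
    'D_v (L \o phi) x = L ('d phi x v).
  move=> cL; have dL := linear_differentiable (phi x) cL.
  rewrite deriveE; last exact: differentiable_comp.
  by rewrite diff_comp //= diff_lin.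
rewrite deriveE; last exact: differentiable_comp.
rewrite diff_comp //= -deriveE // derive_basis //; apply: eq_bigr => j _.
by congr (_ * _ + _ * _); apply/esym;
  [exact: (dlin _ (@xc_continuous j)) | exact: (dlin _ (@yc_continuous j))].
Qed.

End Smoothness.

(** * Closure properties of the class C^k on an open set *)

Section ClassC.
Variables (R : realType) (n : nat) (D : set (Cn R n)).
Hypothesis oD : open D.
Notation E := (Cn R n).
Implicit Types (f g : E -> R) (k : nat).

Lemma open_near (P : E -> Prop) (x : E) :
  D x -> (forall w, D w -> P w) -> \forall w \near x, P w.
Proof. by move=> Dx DP; apply: filterS DP _; exact: open_nbhs_nbhs. Qed.

(** Since [D] is open, equality on [D] is equality near each of its points and so passes to all
    derivatives. Differentiation formulas valid only on [D] enter the later inductions this way. *)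
Lemma class_C_ext k f g :
  (forall x, D x -> f x = g x) -> class_C k D f -> class_C k D g.
Proof.
elim: k f g => [|k IH] f g fg /=.
  move=> cf x Dx; rewrite /prop_for /continuous_at -fg //.
  by apply: cvg_trans (cf x Dx); apply: near_eq_cvg; exact: open_near.
case=> df cf; split=> [x Dx|v].
  by apply: near_eq_differentiable (df x Dx); exact: open_near.
apply: IH (cf v) => x Dx; apply: near_eq_derive; exact: open_near.
Qed.

Lemma class_C_pred k f : class_C k.+1 D f -> class_C k D f.
Proof.
elim: k f => [|k IH] f [df cf].
  by move=> x Dx; apply: differentiable_continuous; exact: df.
by split=> // v; apply: IH.
Qed.

Lemma class_C_cst k (c : R) : class_C k D (fun=> c).
Proof.
elim: k c => [|k IH] c /=; first by move=> x _; exact: cst_continuous.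
split=> [x _|v]; first exact: differentiable_cst.
apply: class_C_ext (IH 0) => x _; by rewrite (derive_cst c).
Qed.

Lemma class_C_xcoord k j : class_C k D (fun w : E => w.1 0 j : R).
Proof.
case: k => [x _|k]; first exact/differentiable_continuous/differentiable_xcoord.
split=> [x _|v]; first exact: differentiable_xcoord.
apply: class_C_ext (class_C_cst k (v.1 0 j)) => x _; by rewrite derive_xcoord.
Qed.

Lemma class_C_ycoord k j : class_C k D (fun w : E => w.2 0 j : R).
Proof.
case: k => [x _|k]; first exact/differentiable_continuous/differentiable_ycoord.
split=> [x _|v]; first exact: differentiable_ycoord.
apply: class_C_ext (class_C_cst k (v.2 0 j)) => x _; by rewrite derive_ycoord.
Qed.

Lemma class_CD k f g : class_C k D f -> class_C k D g ->
  class_C k D (fun x => f x + g x).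
Proof.
elim: k f g => [|k IH] f g.
  by move=> cf cg x Dx; apply: cvgD; [exact: cf|exact: cg].
case=> df cf [dg cg]; split=> [x Dx|v].
  by apply: (@differentiableD _ _ _ f g); [exact: df|exact: dg].
apply: class_C_ext (IH _ _ (cf v) (cg v)) => x Dx.
by rewrite -(deriveD (diff_derivable (df _ Dx)) (diff_derivable (dg _ Dx))).
Qed.

Lemma class_CM k f g : class_C k D f -> class_C k D g ->
  class_C k D (fun x => f x * g x).
Proof.
elim: k f g => [|k IH] f g.
  by move=> cf cg x Dx; apply: cvgM; [exact: cf|exact: cg].
move=> cf cg; have [df {}cf'] := cf; have [dg cg'] := cg; split=> [x Dx|v].
  by apply: (@differentiableM _ _ f g); [exact: df|exact: dg].
apply: class_C_ext (class_CD (IH _ _ (class_C_pred cf) (cg' v))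
  (IH _ _ (class_C_pred cg) (cf' v))) => x Dx.
by rewrite [RHS](deriveM (diff_derivable (df _ Dx)) (diff_derivable (dg _ Dx))).
Qed.

Lemma class_CN k f : class_C k D f -> class_C k D (fun x => - f x).
Proof.
move=> cf; apply: class_C_ext (class_CM (class_C_cst k (-1)) cf) => x _.
by rewrite mulN1r.
Qed.

Lemma class_C_sum k (I : Type) (r : seq I) (F : I -> E -> R) :
  (forall i, class_C k D (F i)) -> class_C k D (fun x => \sum_(i <- r) F i x).
Proof.
move=> cF; elim: r => [|i r IH].
  by apply: class_C_ext (class_C_cst k 0) => x _; rewrite big_nil.
by apply: class_C_ext (class_CD (cF i) IH) => x _; rewrite big_cons.
Qed.

(** The derivative of 1/f is -(1/f)(1/f) f', where 1/f is of class C^k by the induction hypothesis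
    and f' by assumption. *)
Lemma class_CV k f : (forall x, D x -> f x != 0) -> class_C k D f ->
  class_C k D (fun x => (f x)^-1).
Proof.
move=> f0; elim: k => [|k IH].
  by move=> cf x Dx; apply: cvgV; [exact: f0|exact: cf].
move=> cf; have [df cf'] := cf; split=> [x Dx|v].
  by apply: differentiableV; [exact: df|exact: f0].
have cV := IH (class_C_pred cf).
apply: class_C_ext (class_CM (class_CN (class_CM cV cV)) (cf' v)) => x Dx.
rewrite [RHS](deriveV (f0 _ Dx) (diff_derivable (df _ Dx))).
by rewrite expr2 invfM.
Qed.

(** A derivative of [f \o phi] is a sum of products of derivatives of the coordinates of [phi] with
    composites of partial derivatives of [f], to which the induction applies. Smoothness of [phi] to
    every order keeps its order out of the induction. *)
Lemma class_C_comp k f (phi : E -> E) :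
  (forall x, D x -> D (phi x)) ->
  (forall m j, class_C m D (fun w => (phi w).1 0 j : R)) ->
  (forall m j, class_C m D (fun w => (phi w).2 0 j : R)) ->
  class_C k D f -> class_C k D (f \o phi).
Proof.
move=> Dphi c1 c2.
have d1 x j : D x -> differentiable (fun w => (phi w).1 0 j : R) x.
  by move=> Dx; have [+ _] := c1 1%N j; apply.
have d2 x j : D x -> differentiable (fun w => (phi w).2 0 j : R) x.
  by move=> Dx; have [+ _] := c2 1%N j; apply.
have dphi x : D x -> differentiable phi x.
  by move=> Dx; apply: differentiable_to_Cn => j; [exact: d1|exact: d2].
elim: k f => [|k IH] f.
  move=> cf x Dx; apply: continuous_comp; last exact/cf/Dphi.
  exact/differentiable_continuous/dphi.
case=> df cf; split=> [x Dx|v].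
  by apply: differentiable_comp; [exact: dphi|exact/df/Dphi].
apply: class_C_ext (class_C_sum (index_enum 'I_n) (fun j => class_CD
  (class_CM (proj2 (c1 k.+1 j) v) (IH _ (cf (xdir R j))))
  (class_CM (proj2 (c2 k.+1 j) v) (IH _ (cf (ydir R j)))))) => x Dx /=.
rewrite (derive_comp _ (fun j => d1 x j Dx) (fun j => d2 x j Dx)) //.
exact/df/Dphi.
Qed.

End ClassC.

(** * Wirtinger calculus and composition *)

Section Wirtinger.
Variables (R : realType) (n : nat).
Notation E := (Cn R n).
Notation C := R[i].
Notation Re := complex.Re.
Notation Im := complex.Im.
Implicit Types (F G : E -> C) (v x : E).

(** The identities below live in an abstract ring or field so that [ring] and [field] see only
    variables; [i] stands for the imaginary unit and [h] for one half. *)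
Let dzD_alg (K : comRingType) (a b c d i h : K) :
  ((a + b) - i * (c + d)) * h = (a - i * c) * h + (b - i * d) * h.
Proof. ring. Qed.
Let dzbarD_alg (K : comRingType) (a b c d i h : K) :
  ((a + b) + i * (c + d)) * h = (a + i * c) * h + (b + i * d) * h.
Proof. ring. Qed.
Let dzM_alg (K : comRingType) (a b c d f g i h : K) :
  ((a * g + f * b) - i * (c * g + f * d)) * h =
  (a - i * c) * h * g + f * ((b - i * d) * h).
Proof. ring. Qed.
Let dzbarM_alg (K : comRingType) (a b c d f g i h : K) :
  ((a * g + f * b) + i * (c * g + f * d)) * h =
  (a + i * c) * h * g + f * ((b + i * d) * h).
Proof. ring. Qed.
Let dz_comp_alg (K : comRingType) (a b c d p q i h : K) :
  ((p * a + q * b) - i * (p * c + q * d)) * h =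
  p * ((a - i * c) * h) + q * ((b - i * d) * h).
Proof. ring. Qed.
Let dzbar_comp_alg (K : comRingType) (a b c d p q i h : K) :
  ((p * a + q * b) + i * (p * c + q * d)) * h =
  p * ((a + i * c) * h) + q * ((b + i * d) * h).
Proof. ring. Qed.
Let dz_dzbar_alg (K : fieldType) (i a b X Y : K) : i * i = -1 -> 2%:R != 0 :> K ->
  a * X + b * Y =
  (X - i * Y) / 2%:R * (a + i * b) + (X + i * Y) / 2%:R * (a - i * b).
Proof.
(* Once bY is written as -i^2 bY, the claim holds identically in [i]. *)
move=> i2 n2; have -> : b * Y = - (i * i) * (b * Y) by rewrite i2 opprK mul1r.
by field.
Qed.

Lemma ReD (a b : C) : Re (a + b) = Re a + Re b. Proof. by case: a b => ? ? []. Qed.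
Lemma ImD (a b : C) : Im (a + b) = Im a + Im b. Proof. by case: a b => ? ? []. Qed.
Lemma ReM (a b : C) : Re (a * b) = Re a * Re b - Im a * Im b.
Proof. by case: a b => ? ? []. Qed.
Lemma ImM (a b : C) : Im (a * b) = Re a * Im b + Im a * Re b.
Proof. by case: a b => ? ? []. Qed.
Lemma ReZ (a : R) (c : C) : Re (a%:C * c) = a * Re c.
Proof. by case: c => x y; rewrite ReM /= mul0r subr0. Qed.
Lemma ImZ (a : R) (c : C) : Im (a%:C * c) = a * Im c.
Proof. by case: c => x y; rewrite ImM /= mul0r addr0. Qed.
Let Re_lin (a b p q r s : R) :
  a * p + b * r = Re (a%:C * (p +i* q) + b%:C * (r +i* s)).
Proof. by rewrite ReD !ReZ. Qed.
Let Im_lin (a b p q r s : R) :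
  a * q + b * s = Im (a%:C * (p +i* q) + b%:C * (r +i* s)).
Proof. by rewrite ImD !ImZ. Qed.
Lemma ReJ (a : C) : Re (conjc a) = Re a. Proof. by case: a. Qed.
Lemma ImJ (a : C) : Im (conjc a) = - Im a. Proof. by case: a. Qed.
Lemma conjcD (a b : C) : conjc (a + b) = conjc a + conjc b.
Proof. exact: (rmorphD (@conjc R)). Qed.
Lemma conjcM (a b : C) : conjc (a * b) = conjc a * conjc b.
Proof. exact: (rmorphM (@conjc R)). Qed.
Lemma complex_ext (a b : C) : Re a = Re b -> Im a = Im b -> a = b.
Proof. by case: a b => ? ? [? ?] /= -> ->. Qed.

Lemma Re_sum (I : Type) (r : seq I) (F : I -> C) :
  Re (\sum_(i <- r) F i) = \sum_(i <- r) Re (F i).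
Proof. by rewrite (big_morph (@Re R) ReD (erefl _)). Qed.
Lemma Im_sum (I : Type) (r : seq I) (F : I -> C) :
  Im (\sum_(i <- r) F i) = \sum_(i <- r) Im (F i).
Proof. by rewrite (big_morph (@Im R) ImD (erefl _)). Qed.

(** Real differentiability of both parts, which is what the sum, product and chain rules for
    [cderive] require. *)
Definition cdiff F x :=
  differentiable (fun w => Re (F w)) x /\ differentiable (fun w => Im (F w)) x.

Lemma cdiff_cst (c : C) x : cdiff (fun=> c) x.
Proof. by split; exact: differentiable_cst. Qed.

Lemma cdiffD F G x : cdiff F x -> cdiff G x -> cdiff (fun w => F w + G w) x.
Proof.
move=> [f1 f2] [g1 g2]; split.
  by under eq_fun do rewrite ReD; exact: (differentiableD f1 g1).
by under eq_fun do rewrite ImD; exact: (differentiableD f2 g2).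
Qed.

Lemma cdiffM F G x : cdiff F x -> cdiff G x -> cdiff (fun w => F w * G w) x.
Proof.
move=> [f1 f2] [g1 g2]; split.
  under eq_fun do rewrite ReM.
  exact: (differentiableB (differentiableM f1 g1) (differentiableM f2 g2)).
under eq_fun do rewrite ImM.
exact: (differentiableD (differentiableM f1 g2) (differentiableM f2 g1)).
Qed.

Lemma cdiffJ F x : cdiff F x -> cdiff (fun w => conjc (F w)) x.
Proof.
move=> [f1 f2]; split; first by under eq_fun do rewrite ReJ.
under eq_fun do rewrite ImJ; exact: (differentiableN f2).
Qed.

Lemma cdiff_zcoord j x : cdiff (fun w : E => zcoord w j) x.
Proof. by split; [exact: differentiable_xcoord|exact: differentiable_ycoord]. Qed.

Lemma near_eq_cderive F G v x :
  (\near x, F x = G x) -> cderive v F x = cderive v G x.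
Proof.
move=> FG; rewrite /cderive; congr (_ +i* _); apply: near_eq_derive;
  by apply: filterS FG => w ->.
Qed.

Lemma cderive_cst v (c : C) x : cderive v (fun=> c) x = 0.
Proof. by apply: complex_ext => /=; exact: derive_cst. Qed.

Lemma cderive_zcoord v j x : cderive v (fun w : E => zcoord w j) x = zcoord v j.
Proof. by rewrite /cderive /zcoord /= derive_xcoord derive_ycoord. Qed.

Lemma cderiveD v F G x : cdiff F x -> cdiff G x ->
  cderive v (fun w => F w + G w) x = cderive v F x + cderive v G x.
Proof.
move=> [f1 f2] [g1 g2]; apply: complex_ext; rewrite ?ReD ?ImD /=.
  under eq_fun do rewrite ReD.
  exact: (deriveD (diff_derivable f1) (diff_derivable g1)).
under eq_fun do rewrite ImD.
exact: (deriveD (diff_derivable f2) (diff_derivable g2)).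
Qed.

Lemma cderiveJ v F x : cdiff F x ->
  cderive v (fun w => conjc (F w)) x = conjc (cderive v F x).
Proof.
move=> [f1 f2]; apply: complex_ext; rewrite ?ReJ ?ImJ /=.
  by under eq_fun do rewrite ReJ.
under eq_fun do rewrite ImJ.
exact: (deriveN (diff_derivable f2)).
Qed.

Lemma cderiveM v F G x : cdiff F x -> cdiff G x ->
  cderive v (fun w => F w * G w) x = cderive v F x * G x + F x * cderive v G x.
Proof.
move=> [f1 f2] [g1 g2].
have M (f g : E -> R) : differentiable f x -> differentiable g x ->
    'D_v (fun w => f w * g w) x = f x * 'D_v g x + g x * 'D_v f x.
  by move=> df dg; exact: (deriveM (diff_derivable df) (diff_derivable dg)).
apply: complex_ext; rewrite ?(ReD, ImD, ReM, ImM) /=.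
  under eq_fun do rewrite ReM.
  rewrite (deriveB (diff_derivable (differentiableM f1 g1))
     (diff_derivable (differentiableM f2 g2))) !M //; ring.
under eq_fun do rewrite ImM.
rewrite (deriveD (diff_derivable (differentiableM f1 g2))
     (diff_derivable (differentiableM f2 g1))) !M //; ring.
Qed.

Lemma cdiff_sum (I : Type) (r : seq I) (F : I -> E -> C) x :
  (forall i, cdiff (F i) x) -> cdiff (fun w => \sum_(i <- r) F i w) x.
Proof.
move=> dF; elim: r => [|i r IH].
  by under eq_fun do rewrite big_nil; exact: cdiff_cst.
by under eq_fun do rewrite big_cons; exact: cdiffD.
Qed.

Lemma cderive_sum v (I : Type) (r : seq I) (F : I -> E -> C) x :
  (forall i, cdiff (F i) x) ->
  cderive v (fun w => \sum_(i <- r) F i w) x = \sum_(i <- r) cderive v (F i) x.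
Proof.
move=> dF; elim: r => [|i r IH].
  by rewrite big_nil; under eq_fun do rewrite big_nil; exact: cderive_cst.
rewrite big_cons -IH; under eq_fun do rewrite big_cons.
by rewrite cderiveD //; exact: cdiff_sum.
Qed.

Lemma near_eq_dz j F G x : (\near x, F x = G x) -> dz j F x = dz j G x.
Proof. by move=> FG; rewrite /dz !(near_eq_cderive _ FG). Qed.

Lemma near_eq_dzbar j F G x : (\near x, F x = G x) -> dzbar j F x = dzbar j G x.
Proof. by move=> FG; rewrite /dzbar !(near_eq_cderive _ FG). Qed.

Lemma dz_cst j (c : C) x : dz j (fun=> c : C) x = 0.
Proof. by rewrite /dz !cderive_cst mulr0 subr0 mul0r. Qed.

Lemma dzbar_cst j (c : C) x : dzbar j (fun=> c : C) x = 0.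
Proof. by rewrite /dzbar !cderive_cst mulr0 addr0 mul0r. Qed.

Lemma dzD j F G x : cdiff F x -> cdiff G x ->
  dz j (fun w => F w + G w) x = dz j F x + dz j G x.
Proof. by move=> dF dG; rewrite /dz !cderiveD // dzD_alg. Qed.

Lemma dzbarD j F G x : cdiff F x -> cdiff G x ->
  dzbar j (fun w => F w + G w) x = dzbar j F x + dzbar j G x.
Proof. by move=> dF dG; rewrite /dzbar !cderiveD // dzbarD_alg. Qed.

Lemma dzM j F G x : cdiff F x -> cdiff G x ->
  dz j (fun w => F w * G w) x = dz j F x * G x + F x * dz j G x.
Proof. by move=> dF dG; rewrite /dz !cderiveM // dzM_alg. Qed.

Lemma dzbarM j F G x : cdiff F x -> cdiff G x ->
  dzbar j (fun w => F w * G w) x = dzbar j F x * G x + F x * dzbar j G x.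
Proof. by move=> dF dG; rewrite /dzbar !cderiveM // dzbarM_alg. Qed.

Lemma dz_sum j (I : Type) (r : seq I) (F : I -> E -> C) x :
  (forall i, cdiff (F i) x) ->
  dz j (fun w => \sum_(i <- r) F i w) x = \sum_(i <- r) dz j (F i) x.
Proof.
by move=> dF; rewrite /dz !cderive_sum // mulr_sumr -sumrB mulr_suml.
Qed.

Lemma dzbar_sum j (I : Type) (r : seq I) (F : I -> E -> C) x :
  (forall i, cdiff (F i) x) ->
  dzbar j (fun w => \sum_(i <- r) F i w) x = \sum_(i <- r) dzbar j (F i) x.
Proof.
by move=> dF; rewrite /dzbar !cderive_sum // mulr_sumr -big_split /= mulr_suml.
Qed.

Lemma dzJ j F x : cdiff F x -> dz j (fun w => conjc (F w)) x = conjc (dzbar j F x).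
Proof.
move=> dF; rewrite /dz /dzbar !cderiveJ //.
have Ji : conjc (0 +i* 1 : C) = - (0 +i* 1).
  by apply: complex_ext; rewrite /= ?oppr0.
by rewrite conjcM conjcD conjcM Ji conjc_inv conjc_nat mulNr.
Qed.

(** This splits the real differential of [F] into its complex linear and antilinear parts. *)
Lemma cderive_dz v F x : cdiff F x ->
  cderive v F x =
  \sum_(k < n) (dz k F x * zcoord v k + dzbar k F x * conjc (zcoord v k)).
Proof.
move=> [f1 f2].
have i2 : (0 +i* 1 : C) * (0 +i* 1) = -1 by rewrite -expr2 sqr_i.
transitivity (\sum_(k < n) ((v.1 0 k)%:C * cderive (xdir R k) F x
   + (v.2 0 k)%:C * cderive (ydir R k) F x)).
  apply: complex_ext; rewrite /cderive /=.
    rewrite derive_basis // Re_sum.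
    by apply: eq_bigr => k _; exact: Re_lin.
  rewrite derive_basis // Im_sum.
  by apply: eq_bigr => k _; exact: Im_lin.
apply: eq_bigr => k _.
have zE : zcoord v k = (v.1 0 k)%:C + (0 +i* 1) * (v.2 0 k)%:C.
  by apply: complex_ext; rewrite /zcoord ?(ReD, ImD) ?(ReM, ImM) /=; ring.
have zJE : conjc (zcoord v k) = (v.1 0 k)%:C - (0 +i* 1) * (v.2 0 k)%:C.
  by apply: complex_ext; rewrite /zcoord ?(ReD, ImD) /=; ring.
rewrite zJE zE /dz /dzbar.
by apply: dz_dzbar_alg; rewrite // pnatr_eq0.
Qed.

Lemma cderive_comp v F (phi : E -> E) x :
  (forall k, cdiff (fun w => zcoord (phi w) k) x) -> cdiff F (phi x) ->
  cderive v (F \o phi) x = \sum_(k < n)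
    (dz k F (phi x) * cderive v (fun w => zcoord (phi w) k) x +
     dzbar k F (phi x) * conjc (cderive v (fun w => zcoord (phi w) k) x)).
Proof.
move=> dphi dF; have [f1 f2] := dF.
have d1 k := (dphi k).1; have d2 k := (dphi k).2.
(* [u] is the image of [v] under the real differential of [phi]; both sides are the derivative of
   [F] at [phi x] along [u]. *)
pose u : E := (\row_k 'D_v (fun w => (phi w).1 0 k : R) x,
               \row_k 'D_v (fun w => (phi w).2 0 k : R) x).
have uE k : cderive v (fun w => zcoord (phi w) k) x = zcoord u k.
  by rewrite /zcoord /= !mxE.
transitivity (cderive u F (phi x)); last first.
  by rewrite cderive_dz //; apply: eq_bigr => k _; rewrite uE.
rewrite /cderive; congr (_ +i* _).
  rewrite (derive_comp (f := fun w => Re (F w))) // derive_basis //.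
  by apply: eq_bigr => k _; rewrite !mxE.
rewrite (derive_comp (f := fun w => Im (F w))) // derive_basis //.
by apply: eq_bigr => k _; rewrite !mxE.
Qed.

(** The second terms come from the conjugate coordinates of [phi], whose [dz] is the conjugate of
    [dzbar]. They vanish when [phi] is holomorphic. *)
Lemma dz_comp i F (phi : E -> E) x :
  (forall k, cdiff (fun w => zcoord (phi w) k) x) -> cdiff F (phi x) ->
  dz i (F \o phi) x = \sum_(k < n)
    (dz k F (phi x) * dz i (fun w => zcoord (phi w) k) x +
     dzbar k F (phi x) * conjc (dzbar i (fun w => zcoord (phi w) k) x)).
Proof.
move=> dphi dF; under eq_bigr do rewrite -dzJ // /dz !cderiveJ //.
rewrite [LHS]/dz !cderive_comp // mulr_sumr -sumrB mulr_suml.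
by apply: eq_bigr => k _; exact: dz_comp_alg.
Qed.

Lemma dzbarJ j F x : cdiff F x ->
  dzbar j (fun w => conjc (F w)) x = conjc (dz j F x).
Proof.
move=> dF; rewrite -[RHS]conjcK -[LHS]conjcK -dzJ; last exact: cdiffJ.
by congr conjc; rewrite conjcK; under eq_fun do rewrite conjcK.
Qed.

Lemma dzbar_comp i F (phi : E -> E) x :
  (forall k, cdiff (fun w => zcoord (phi w) k) x) -> cdiff F (phi x) ->
  dzbar i (F \o phi) x = \sum_(k < n)
    (dz k F (phi x) * dzbar i (fun w => zcoord (phi w) k) x +
     dzbar k F (phi x) * conjc (dz i (fun w => zcoord (phi w) k) x)).
Proof.
move=> dphi dF; under eq_bigr do rewrite -dzbarJ // /dzbar !cderiveJ //.
rewrite [LHS]/dzbar !cderive_comp // mulr_sumr -big_split /= mulr_suml.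
by apply: eq_bigr => k _; exact: dzbar_comp_alg.
Qed.

Lemma dz_zcoord i k x : dz i (fun w : E => zcoord w k) x = (i == k)%:R.
Proof.
rewrite /dz !cderive_zcoord /zcoord /= !mxE !eqxx /= eq_sym.
case: eqP => _ /=; last by apply: complex_ext; rewrite /= ?(ReM, ImM) /=; ring.
have -> : (0 +i* 1) * (0 +i* 1%:R) = -1 :> C by rewrite -[1%:R]/1 -expr2 sqr_i.
by rewrite opprK -[(1%:R +i* 0)]/(1 : C); field.
Qed.

Lemma dzbar_zcoord i k x : dzbar i (fun w : E => zcoord w k) x = 0.
Proof.
rewrite /dzbar !cderive_zcoord /zcoord /= !mxE !eqxx /= eq_sym.
case: eqP => _ /=; last by apply: complex_ext; rewrite /= ?(ReM, ImM) /=; ring.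
have -> : (0 +i* 1) * (0 +i* 1%:R) = -1 :> C by rewrite -[1%:R]/1 -expr2 sqr_i.
by rewrite -[(1%:R +i* 0)]/(1 : C) subrr mul0r.
Qed.

End Wirtinger.

(** * Complex-valued functions of class C^k *)

Section ComplexClassC.
Variables (R : realType) (n : nat).
Notation E := (Cn R n).
Notation C := R[i].
Notation Re := complex.Re.
Notation Im := complex.Im.
Implicit Types (F G : E -> C) (k : nat).

Lemma enorm_lt1 (z : E) : (enorm z < 1) = (rdot z z < 1).
Proof.
by rewrite /enorm -[X in _ < X]sqrtr1 ltr_sqrt.
Qed.

(** The topology of [Cn] is that of the max norm, so openness of the Euclidean ball is drawn from
    continuity of the quadratic form [rdot z z]. *)
Lemma open_unit_ball : open (unit_ball : set E).
Proof.
have -> : (unit_ball : set E) = (fun z : E => rdot z z) @^-1` [set r | r < 1].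
  by apply/seteqP; split => z; rewrite /unit_ball /= enorm_lt1.
apply: open_comp; last exact: open_lt.
move=> z _.
have : class_C 0 [set: E] (fun z => rdot z z); last exact.
apply: (class_C_sum openT) => j; apply: (class_CD openT); apply: (class_CM openT).
- exact: (class_C_xcoord openT).
- exact: (class_C_xcoord openT).
- exact: (class_C_ycoord openT).
- exact: (class_C_ycoord openT).
Qed.

Variable D : set E.
Hypothesis oD : open D.

Definition cclass k F := class_C k D (fun w => Re (F w)) /\
  class_C k D (fun w => Im (F w)).

Lemma cclass_ext k F G : (forall x, D x -> F x = G x) -> cclass k F -> cclass k G.
Proof.
by move=> FG [F1 F2]; split; [apply: (class_C_ext oD) F1|apply: (class_C_ext oD) F2]
   => x Dx; rewrite FG.
Qed.

Lemma cclass_cdiff k F x : cclass k.+1 F -> D x -> cdiff F x.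
Proof. by move=> [[F1 _] [F2 _]] Dx; split; [exact: F1|exact: F2]. Qed.

Lemma cclass_cderive k F v : cclass k.+1 F -> cclass k (cderive v F).
Proof. by move=> [[_ F1] [_ F2]]; split; [exact: F1|exact: F2]. Qed.

Lemma cclass_cst k (c : C) : cclass k (fun=> c).
Proof. by split; exact: class_C_cst. Qed.

Lemma cclass_zcoord k j : cclass k (fun w => zcoord w j).
Proof. by split; [exact: class_C_xcoord|exact: class_C_ycoord]. Qed.

Lemma cclassD k F G : cclass k F -> cclass k G -> cclass k (fun w => F w + G w).
Proof.
move=> [F1 F2] [G1 G2]; split.
  by apply: (class_C_ext oD) (class_CD oD F1 G1) => x _; rewrite ReD.
by apply: (class_C_ext oD) (class_CD oD F2 G2) => x _; rewrite ImD.
Qed.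

Lemma cclassM k F G : cclass k F -> cclass k G -> cclass k (fun w => F w * G w).
Proof.
move=> [F1 F2] [G1 G2]; split.
  apply: (class_C_ext oD) (class_CD oD (class_CM oD F1 G1)
    (class_CN oD (class_CM oD F2 G2))) => x _; by rewrite ReM.
apply: (class_C_ext oD) (class_CD oD (class_CM oD F1 G2)
    (class_CM oD F2 G1)) => x _; by rewrite ImM.
Qed.

Lemma cclass_sum k (I : Type) (r : seq I) (F : I -> E -> C) :
  (forall i, cclass k (F i)) -> cclass k (fun w => \sum_(i <- r) F i w).
Proof.
move=> cF; split.
  apply: (class_C_ext oD) (class_C_sum oD r (fun i => (cF i).1)) => x _.
  by rewrite Re_sum.
apply: (class_C_ext oD) (class_C_sum oD r (fun i => (cF i).2)) => x _.
by rewrite Im_sum.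
Qed.

Lemma cclassV k F : (forall x, D x -> F x != 0) -> cclass k F ->
  cclass k (fun w => (F w)^-1).
Proof.
move=> F0 [F1 F2].
(* 1/F is conj F / |F|^2, and |F|^2 is a nonvanishing real function of class C^k. *)
have cN : class_C k D (fun w => (Re (F w) * Re (F w) + Im (F w) * Im (F w))^-1).
  apply: (class_CV oD); last by apply: (class_CD oD); apply: (class_CM oD).
  move=> x Dx; apply: contra (F0 x Dx); rewrite -!expr2.
  by rewrite paddr_eq0 ?sqr_ge0 // !sqrf_eq0 eq_complex.
split.
  apply: (class_C_ext oD) (class_CM oD F1 cN) => x _.
  by case: (F x) => a b /=; rewrite -!expr2.
apply: (class_C_ext oD) (class_CN oD (class_CM oD F2 cN)) => x _.
by case: (F x) => a b /=; rewrite -!expr2.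
Qed.

Lemma cclass_comp k F (phi : E -> E) :
  (forall x, D x -> D (phi x)) ->
  (forall m j, cclass m (fun w => zcoord (phi w) j)) ->
  cclass k F -> cclass k (F \o phi).
Proof.
move=> Dphi cphi [F1 F2]; split; apply: (class_C_comp oD (f := fun w => _ (F w)));
  by [| move=> m j; exact: (cphi m j).1 | move=> m j; exact: (cphi m j).2].
Qed.

Lemma cclass_dz k F j : cclass k.+1 F -> cclass k (dz j F).
Proof.
move=> cF; rewrite /dz; apply: cclassM; last exact: cclass_cst.
have -> : (fun z => cderive (xdir R j) F z - (0 +i* 1) * cderive (ydir R j) F z) =
  (fun z => cderive (xdir R j) F z + (- (0 +i* 1)) * cderive (ydir R j) F z).
  by apply/funext => z; rewrite mulNr.
apply: cclassD; first exact: cclass_cderive.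
by apply: cclassM; [exact: cclass_cst|exact: cclass_cderive].
Qed.

Lemma cclass_dzbar k F j : cclass k.+1 F -> cclass k (dzbar j F).
Proof.
move=> cF; rewrite /dzbar; apply: cclassM; last exact: cclass_cst.
apply: cclassD; first exact: cclass_cderive.
by apply: cclassM; [exact: cclass_cst|exact: cclass_cderive].
Qed.

End ComplexClassC.

(** * Composition of invariant harmonic functions with holomorphic self-maps of the ball *)

Section Invariance.
Variables (R : realType) (n : nat).
Notation E := (Cn R n).
Notation C := R[i].
Notation B := (unit_ball : set E).
Variable phi : E -> E.
Notation phi_ k := (fun w : E => zcoord (phi w) k).
Hypothesis phiB : forall x, B x -> B (phi x).
Hypothesis phi_smooth : forall m k, cclass B m (phi_ k).
Hypothesis phi_hol : forall x i k, B x -> dzbar i (phi_ k) x = 0.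
(** Holomorphy of the first derivatives of [phi], in a form that involves no exchange of mixed
    derivatives. *)
Hypothesis phi_hol2 : forall x i j k, B x -> dzbar i (dz j (phi_ k)) x = 0.
(** The coefficients of [laplaceB] form, up to a scalar function, the inverse of the Bergman metric.
    The hypothesis [phi_metric] says that [phi] transforms them conformally; the factor [lambda] is
    harmless, since only the vanishing of the Laplacian has to be preserved. *)
Variable lambda : E -> C.
Hypothesis phi_metric : forall x k l, B x ->
  \sum_(i < n) \sum_(j < n) ((i == j)%:R - zcoord x i * conjc (zcoord x j)) *
     (dz i (phi_ k) x * conjc (dz j (phi_ l) x)) =
  lambda x * ((k == l)%:R - zcoord (phi x) k * conjc (zcoord (phi x) l)).

(** For holomorphic [phi] the complex Hessian transforms by the Jacobian on one side and its
    conjugate on the other, without first-order terms. *)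
Lemma dz_dzbar_comp (G : E -> C) i j x : cclass B 2 G -> B x ->
  dz i (dzbar j (G \o phi)) x = \sum_(k < n) \sum_(l < n)
    dz k (dzbar l G) (phi x) * (dz i (phi_ k) x * conjc (dz j (phi_ l) x)).
Proof.
move=> cG Bx.
have oB := @open_unit_ball R n.
have dphi w k : B w -> cdiff (phi_ k) w.
  by move=> Bw; apply: (cclass_cdiff (phi_smooth 1 k)).
have dG w : B w -> cdiff G w by move=> Bw; apply: (cclass_cdiff cG).
have cdbG l : cclass B 1 (dzbar l G) by exact: cclass_dzbar.
have cdphi l : cdiff (dz j (phi_ l)) x.
  exact: (cclass_cdiff (cclass_dz oB j (phi_smooth 2 l)) Bx).
(* The chain rule is used on a neighbourhood of [x], because its result is differentiated again. *)
rewrite (@near_eq_dz R n i _ (fun w => \sum_(l < n)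
   dzbar l G (phi w) * conjc (dz j (phi_ l) w))); last first.
  apply: (open_near oB Bx) => w Bw; rewrite dzbar_comp //.
  - by apply: eq_bigr => l _; rewrite phi_hol // mulr0 add0r.
  - by move=> k; exact: dphi.
  - exact/dG/phiB.
have d1 l : cdiff (fun w => dzbar l G (phi w)) x.
  by apply: cclass_cdiff Bx; exact: (cclass_comp oB phiB phi_smooth (cdbG l)).
rewrite dz_sum; last by move=> l; apply: cdiffM; [exact: d1|exact/cdiffJ/cdphi].
rewrite exchange_big; apply: eq_bigr => l _.
rewrite dzM; [|exact: d1|exact/cdiffJ/cdphi].
(* The conjugated Jacobian entry is antiholomorphic, so [dz i] annihilates it. *)
rewrite dzJ // phi_hol2 // conjc0 mulr0 addr0.
rewrite (@dz_comp R n i (dzbar l G) phi x);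
  [|by move=> k; exact: dphi|]; last first.
  by apply: cclass_cdiff (cdbG l) _; exact: phiB.
rewrite mulr_suml; apply: eq_bigr => k _.
by rewrite phi_hol // conjc0 mulr0 addr0 mulrA.
Qed.

Lemma invariant_harmonic_comp (h : E -> R) :
  invariant_harmonic h -> invariant_harmonic (h \o phi).
Proof.
move=> [ch lh]; have oB := @open_unit_ball R n; split.
  apply: (class_C_comp oB) => //.
  - by move=> m j; exact: (phi_smooth m j).1.
  - by move=> m j; exact: (phi_smooth m j).2.
move=> x Bx.
pose G (w : E) : C := (h w)%:C.
have cG : cclass B 2 G.
  split; first by apply: (class_C_ext oB) ch.
  by apply: (class_C_ext oB) (class_C_cst oB 2 0).
have -> : (fun w => ((h \o phi) w)%:C) = G \o phi by [].
(* The factor 4(1 - |phi x|^2) is nonzero in the ball, so harmonicity of [h] makes the double sum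
   itself vanish. *)
have S0 : \sum_(k < n) \sum_(l < n)
    ((k == l)%:R - zcoord (phi x) k * conjc (zcoord (phi x) l)) *
     dz k (dzbar l G) (phi x) = 0.
  have /eqP := lh _ (phiB Bx).
  rewrite /laplaceB -/G mulf_eq0 mulf_eq0 pnatr_eq0 /= => /orP[|/eqP//].
  have : enorm (phi x) < 1 := phiB Bx.
  move=> p1; rewrite eq_complex /= eqxx andbT subr_eq0 => /eqP e.
  have := expr_lt1 (n := 2) isT (sqrtr_ge0 (rdot (phi x) (phi x))).
  by rewrite -/(enorm _) p1 -e ltxx.
rewrite /laplaceB; apply/eqP; rewrite mulf_eq0; apply/orP; right; apply/eqP.
transitivity (\sum_(i < n) \sum_(j < n) \sum_(k < n) \sum_(l < n)
  dz k (dzbar l G) (phi x) *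
  (((i == j)%:R - zcoord x i * conjc (zcoord x j)) *
     (dz i (phi_ k) x * conjc (dz j (phi_ l) x)))).
  apply: eq_bigr => i _; apply: eq_bigr => j _; rewrite dz_dzbar_comp //.
  rewrite mulr_sumr; apply: eq_bigr => k _; rewrite mulr_sumr.
  by apply: eq_bigr => l _; rewrite mulrCA.
(* The exchanges move [k], [l] outside and [i], [j] inside, where [phi_metric] evaluates the inner
   sum. *)
under eq_bigr do rewrite exchange_big /=.
rewrite exchange_big /=.
under eq_bigr do under eq_bigr do rewrite exchange_big /=.
under eq_bigr do rewrite exchange_big /=.
transitivity (\sum_(k < n) \sum_(l < n) lambda x *
  (((k == l)%:R - zcoord (phi x) k * conjc (zcoord (phi x) l)) *
     dz k (dzbar l G) (phi x))).
  apply: eq_bigr => k _; apply: eq_bigr => l _.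
  under eq_bigr do rewrite -mulr_sumr.
  by rewrite -mulr_sumr phi_metric // mulrC -mulrA.
under eq_bigr do rewrite -mulr_sumr.
by rewrite -mulr_sumr S0 mulr0.
Qed.

End Invariance.

(** * Automorphisms of the ball *)

Section Reflection.
Variables (R : realType) (n : nat).
Notation E := (Cn R n).
Notation C := R[i].
Notation B := (unit_ball : set E).

Lemma rdotC_sum (x : E) :
  (rdot x x)%:C = \sum_(i < n) zcoord x i * conjc (zcoord x i).
Proof.
apply: complex_ext; rewrite ?Re_sum ?Im_sum.
  by apply: eq_bigr => i _; rewrite ReM ReJ ImJ mulrN opprK.
rewrite [RHS]big1 // => i _; rewrite ImM ReJ ImJ mulrN mulrC addrC subrr //.
Qed.

Lemma conjc_sum (I : Type) (r : seq I) (F : I -> C) :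
  conjc (\sum_(i <- r) F i) = \sum_(i <- r) conjc (F i).
Proof. by rewrite (big_morph (@conjc R) (@conjcD R) (erefl _)) ?conjc0. Qed.

Lemma conjcN (a : C) : conjc (- a) = - conjc a.
Proof. by case: a. Qed.

(* The linear map [X |-> X - kap * <X, W> * W] with [W = (b, p)], for the form
   [<X, Y> = - X_0 conj Y_0 + sum_i X_i conj Y_i]; [kapP] says that it preserves
   the form.  For [X = (1, x)], [L x] is [<X, W>], and [Den x] and [Num k x] are
   the coordinates of the image. *)
Variables (p : 'I_n -> C) (b kap : C).
Let P := \sum_(i < n) p i * conjc (p i).
Hypothesis kapP : kap + conjc kap = kap * conjc kap * (P - b * conjc b).

Let L (x : E) : C := \sum_(i < n) zcoord x i * conjc (p i) - conjc b.
Let Den x : C := 1 - kap * b * L x.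
Let Num k x : C := zcoord x k - kap * L x * p k.
Let rho k x : C := Num k x / Den x.

Definition reflection (x : E) : E :=
  (\row_k complex.Re (rho k x), \row_k complex.Im (rho k x)).

Lemma zcoord_reflection k x : zcoord (reflection x) k = rho k x.
Proof. by rewrite /zcoord !mxE; case: (rho k x). Qed.

(** Primes stand for conjugates and [S] for |x|^2. The two sides differ by a multiple of the
    relation assumed on [k], which is [kapP]. *)
Let den_num_identity (K : comRingType) (S k k' l l' c c' Q : K) :
  k + k' = k * k' * (Q - c * c') ->
  (1 - k * c * l) * (1 - k' * c' * l') -
  (S - k' * l' * (l + c') - k * l * (l' + c) + k * k' * l * l' * Q) = 1 - S.
Proof.
move=> H; have -> : (1 - k * c * l) * (1 - k' * c' * l') -
  (S - k' * l' * (l + c') - k * l * (l' + c) + k * k' * l * l' * Q) =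
  1 - S + l * l' * (k + k' - k * k' * (Q - c * c')) by ring.
by rewrite H subrr mulr0 addr0.
Qed.

Let num_product (K : comRingType) (k k' l l' z z' q q' : K) :
  (z - k * l * q) * (z' - k' * l' * q') =
  z * z' - k' * l' * (z * q') - k * l * (q * z') + k * k' * l * l' * (q * q').
Proof. ring. Qed.

Let sumzp x : \sum_(i < n) zcoord x i * conjc (p i) = L x + conjc b.
Proof. by rewrite /L subrK. Qed.

Let sumpz x : \sum_(i < n) p i * conjc (zcoord x i) = conjc (L x) + b.
Proof.
rewrite -[b in RHS]conjcK -conjcD -sumzp conjc_sum; apply: eq_bigr => i _.
by rewrite conjcM conjcK mulrC.
Qed.

Let conjDen x : conjc (Den x) = 1 - conjc kap * conjc b * conjc (L x).
Proof. by rewrite /Den conjcD conjcN !conjcM conjc1. Qed.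

Let norm_Num x : \sum_(k < n) Num k x * conjc (Num k x) =
  (rdot x x)%:C - conjc kap * conjc (L x) * (L x + conjc b)
  - kap * L x * (conjc (L x) + b) + kap * conjc kap * L x * conjc (L x) * P.
Proof.
rewrite rdotC_sum -sumzp -sumpz /P !mulr_sumr -!sumrB -big_split /=.
apply: eq_bigr => k _; rewrite {2}/Num conjcD conjcN !conjcM; exact: num_product.
Qed.

(** Preservation of the form, evaluated on [(1, x)] with the sign reversed. Both the nonvanishing of
    [Den] and the stability of the ball follow from it. *)
Let Den_Num x : Den x * conjc (Den x) - \sum_(k < n) Num k x * conjc (Num k x)
  = (1 - rdot x x)%:C.
Proof. by rewrite norm_Num conjDen den_num_identity // rmorphB rmorph1. Qed.

Let sumJ_ge0 (F : 'I_n -> C) : 0 <= \sum_(k < n) F k * conjc (F k).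
Proof. by apply: sumr_ge0 => k _; exact: mulcJ_ge0. Qed.

Let Den_gt0 x : B x -> 0 < Den x * conjc (Den x).
Proof.
rewrite /unit_ball /= enorm_lt1 => x1.
have : 0 < (1 - rdot x x)%:C by rewrite -[0]/(0%:C) ltcR subr_gt0.
rewrite -Den_Num => h; apply: (lt_le_trans h).
by rewrite gerBl; exact: sumJ_ge0.
Qed.

Let Den_neq0 x : B x -> Den x != 0.
Proof. by move=> /Den_gt0; apply: contraTneq => ->; rewrite mul0r ltxx. Qed.

Lemma reflection_ball x : B x -> B (reflection x).
Proof.
move=> Bx; have D0 := Den_gt0 Bx; move: (Bx).
rewrite /unit_ball /= !enorm_lt1 => x1.
rewrite -ltcR rdotC_sum.
have -> : \sum_(i < n) zcoord (reflection x) i * conjc (zcoord (reflection x) i) =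
   (\sum_(k < n) Num k x * conjc (Num k x)) / (Den x * conjc (Den x)).
  rewrite mulr_suml; apply: eq_bigr => i _; rewrite zcoord_reflection /rho.
  by rewrite conjcM conjc_inv mulrACA -invfM.
rewrite rmorph1 ltr_pdivrMr // mul1r -subr_gt0 Den_Num.
by rewrite -[0]/(0%:C) ltcR subr_gt0.
Qed.

(** * Smoothness and holomorphy of the reflection *)

Let oB := @open_unit_ball R n.

Let cclass_L m : cclass B m L.
Proof.
rewrite /L; apply: (cclassD oB); last exact: (cclass_cst oB).
apply: (cclass_sum oB) => i; apply: (cclassM oB); last exact: (cclass_cst oB).
exact: (cclass_zcoord oB).
Qed.

Let cclass_Den m : cclass B m Den.
Proof.
apply: (cclass_ext oB (F := fun x => 1 + (- (kap * b)) * L x)).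
  by move=> x _; rewrite mulNr.
apply: (cclassD oB); first exact: (cclass_cst oB).
by apply: (cclassM oB); first exact: (cclass_cst oB).
Qed.

Let cclass_Num m k : cclass B m (Num k).
Proof.
apply: (cclass_ext oB (F := fun x => zcoord x k + (- (kap * p k)) * L x)).
  by move=> x _; rewrite /Num mulNr mulrAC.
apply: (cclassD oB); first exact: (cclass_zcoord oB).
by apply: (cclassM oB); first exact: (cclass_cst oB).
Qed.

Let cclass_rho m k : cclass B m (rho k).
Proof.
apply: (cclassM oB); first exact: cclass_Num.
by apply: (cclassV oB) => //; exact: cclass_Den.
Qed.

Lemma reflection_smooth m k : cclass B m (fun w => zcoord (reflection w) k).
Proof.
apply: (cclass_ext oB (F := rho k)); last exact: cclass_rho.
by move=> x _; rewrite zcoord_reflection.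
Qed.

Let reflectionE k : (fun w => zcoord (reflection w) k) = rho k.
Proof. by apply/funext => x; rewrite zcoord_reflection. Qed.

Let dz_L i x : B x -> dz i L x = conjc (p i).
Proof.
move=> Bx; have dc (c : C) := cdiff_cst c x.
have dzp j := cdiffM (cdiff_zcoord j x) (dc (conjc (p j))).
rewrite /L (dzD i (cdiff_sum (index_enum 'I_n) dzp) (dc (- conjc b))).
rewrite (dz_sum i (index_enum 'I_n) dzp) dz_cst addr0 (bigD1 i) //= big1 => [|j ji].
  by rewrite (dzM i (cdiff_zcoord i x) (dc _)) dz_zcoord dz_cst eqxx
    mul1r mulr0 !addr0.
rewrite (dzM i (cdiff_zcoord j x) (dc _)) dz_zcoord dz_cst eq_sym (negbTE ji).
by rewrite mul0r mulr0 addr0.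
Qed.

Let dzbar_L i x : B x -> dzbar i L x = 0.
Proof.
move=> Bx; have dc (c : C) := cdiff_cst c x.
have dzp j := cdiffM (cdiff_zcoord j x) (dc (conjc (p j))).
rewrite /L (dzbarD i (cdiff_sum (index_enum 'I_n) dzp) (dc (- conjc b))).
rewrite (dzbar_sum i (index_enum 'I_n) dzp) dzbar_cst addr0 big1 // => j _.
rewrite (dzbarM i (cdiff_zcoord j x) (dc _)) dzbar_zcoord dzbar_cst.
by rewrite mul0r mulr0 addr0.
Qed.

Let cdiff_L x : B x -> cdiff L x.
Proof. exact: (cclass_cdiff (cclass_L 1)). Qed.
Let cdiff_rho k x : B x -> cdiff (rho k) x.
Proof. exact: (cclass_cdiff (cclass_rho 1 k)). Qed.
Let cdiff_Den x : B x -> cdiff Den x.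
Proof. exact: (cclass_cdiff (cclass_Den 1)). Qed.

Let DenE : Den = fun x => 1 + (- (kap * b)) * L x.
Proof. by apply/funext => x; rewrite mulNr. Qed.
Let NumE k : Num k = fun x => zcoord x k + (- (kap * p k)) * L x.
Proof. by apply/funext => x; rewrite /Num mulNr mulrAC. Qed.

Let dz_affine i (c : C) x : B x -> dz i (fun w => c * L w) x = c * conjc (p i).
Proof.
move=> Bx; rewrite (dzM i (cdiff_cst c x) (cdiff_L Bx)) dz_cst dz_L //.
by rewrite mul0r add0r.
Qed.

Let dzbar_affine i (c : C) x : B x -> dzbar i (fun w => c * L w) x = 0.
Proof.
move=> Bx; rewrite (dzbarM i (cdiff_cst c x) (cdiff_L Bx)) dzbar_cst dzbar_L //.
by rewrite mul0r mulr0 add0r.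
Qed.

Let cdiff_affine (c : C) x : B x -> cdiff (fun w => c * L w) x.
Proof. by move=> Bx; exact: (cdiffM (cdiff_cst c x) (cdiff_L Bx)). Qed.

Let dz_Den i x : B x -> dz i Den x = - (kap * b) * conjc (p i).
Proof.
move=> Bx; rewrite DenE (dzD i (cdiff_cst 1 x) (cdiff_affine _ Bx)) dz_cst.
by rewrite dz_affine // add0r.
Qed.

Let dzbar_Den i x : B x -> dzbar i Den x = 0.
Proof.
move=> Bx; rewrite DenE (dzbarD i (cdiff_cst 1 x) (cdiff_affine _ Bx)) dzbar_cst.
by rewrite dzbar_affine // add0r.
Qed.

Let dz_Num i k x : B x -> dz i (Num k) x = (i == k)%:R - (kap * p k) * conjc (p i).
Proof.
move=> Bx; rewrite NumE (dzD i (cdiff_zcoord k x) (cdiff_affine _ Bx)) dz_zcoord.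
by rewrite dz_affine // mulNr.
Qed.

Let dzbar_Num i k x : B x -> dzbar i (Num k) x = 0.
Proof.
move=> Bx; rewrite NumE (dzbarD i (cdiff_zcoord k x) (cdiff_affine _ Bx)).
by rewrite dzbar_zcoord dzbar_affine // add0r.
Qed.

(** The derivatives of the quotient [rho] are all extracted from this relation by the product
    rule. *)
Let rhoDen k x : B x -> rho k x * Den x = Num k x.
Proof. by move=> Bx; rewrite /rho divfK // Den_neq0. Qed.

(** After multiplication by [Den x], the Jacobian of the reflection is the identity plus the
    rank-one matrix with entries T_k conj(p_i). *)
Let T k x : C := - (kap * (p k - b * rho k x)).

Let quotient_rule_identity (K : comRingType) (d k q c r p' : K) :
  d - k * q * p' - r * (- (k * c) * p') = d + - (k * (q - c * r)) * p'.
Proof. ring. Qed.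

Let dz_rhoDen i k x : B x ->
  dz i (rho k) x * Den x = (i == k)%:R + T k x * conjc (p i).
Proof.
move=> Bx; rewrite /T -quotient_rule_identity -(dz_Num i k Bx) -(dz_Den i Bx).
apply/eqP; rewrite eq_sym subr_eq; apply/eqP.
rewrite -(dzM i (cdiff_rho k Bx) (cdiff_Den Bx)); apply: near_eq_dz.
by apply: (open_near oB Bx) => w Bw; rewrite rhoDen.
Qed.

Let dzbar_rho i k x : B x -> dzbar i (rho k) x = 0.
Proof.
move=> Bx; apply: (mulIf (Den_neq0 Bx)); rewrite mul0r.
rewrite -(dzbar_Num i k Bx) (@near_eq_dzbar R n i (Num k) (fun w => rho k w * Den w)).
  by rewrite (dzbarM i (cdiff_rho k Bx) (cdiff_Den Bx)) dzbar_Den // mulr0 addr0.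
by apply: (open_near oB Bx) => w Bw; rewrite rhoDen.
Qed.

Lemma reflection_hol x i k : B x -> dzbar i (fun w => zcoord (reflection w) k) x = 0.
Proof. by rewrite reflectionE; exact: dzbar_rho. Qed.

(** [Den] times [dz j (rho k)] is the affine function [c1 + c2 * rho k] of [rho k], hence
    holomorphic, and [Den] is holomorphic without zeros in the ball. *)
Lemma reflection_hol2 x i j k : B x ->
  dzbar i (dz j (fun w => zcoord (reflection w) k)) x = 0.
Proof.
move=> Bx; rewrite reflectionE.
have cM : cdiff (dz j (rho k)) x.
  exact: (cclass_cdiff (cclass_dz oB j (cclass_rho 2 k)) Bx).
apply: (mulIf (Den_neq0 Bx)); rewrite mul0r.
have -> : dzbar i (dz j (rho k)) x * Den x =
    dzbar i (fun w => dz j (rho k) w * Den w) x.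
  by rewrite (dzbarM i cM (cdiff_Den Bx)) dzbar_Den // mulr0 addr0.
pose c1 : C := (j == k)%:R - kap * p k * conjc (p j).
pose c2 : C := kap * b * conjc (p j).
rewrite (@near_eq_dzbar R n i _ (fun w => c1 + c2 * rho k w)).
  have d2 := cdiffM (cdiff_cst c2 x) (cdiff_rho k Bx).
  rewrite (dzbarD i (cdiff_cst c1 x) d2) (dzbarM i (cdiff_cst c2 x) (cdiff_rho k Bx)).
  by rewrite !dzbar_cst dzbar_rho // mulr0 mul0r !addr0.
apply: (open_near oB Bx) => w Bw; rewrite dz_rhoDen //.
rewrite /T -quotient_rule_identity /c1 /c2.
by rewrite mulNr mulrN opprK [rho k w * _]mulrC.
Qed.

(** The closed form of [phi_metric] once all sums are evaluated and [Den] is cleared; again the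
    discrepancy is a multiple of the relation [kapP]. *)
Let metric_identity (K : comRingType) (d q q' r r' c c' k k' l l' Q : K) :
  k + k' = k * k' * (Q - c * c') ->
  let t := - (k * (q - c * r)) in let t' := - (k' * (q' - c' * r')) in
  d + t' * q + t * q' + t * t' * Q 
  - (r - l * t + t * (l + c')) * (r' - l' * t' + t' * (l' + c))
  = d - r * r'.
Proof.
move=> H t t'.
rewrite (_ : _ - _ = d - r * r' - (q - c * r) * (q' - c' * r') *
   (k + k' - k * k' * (Q - c * c'))).
  by rewrite H subrr mulr0 subr0.
rewrite /t /t'; ring.
Qed.

Let product_identity (K : comRingType) (di dk t t' q q' : K) :
  (di + t * q') * (dk + t' * q) =
  di * dk + t' * (di * q) + t * (dk * q') + t * t' * (q * q').
Proof. ring. Qed.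

Let metric_term (K : comRingType) (D D' d z z' X Y : K) :
  D * D' * ((d - z * z') * (X * Y)) =
  d * ((D * X) * (D' * Y)) - (D * X * z) * (D' * Y * z').
Proof. ring. Qed.

Let fixed_part_identity (K : comRingType) (r k c l q : K) :
  r * (1 - k * c * l) + k * l * q = r - l * (- (k * (q - c * r))).
Proof. ring. Qed.

Let conjc_alg (r l t c : C) : conjc (r - l * t + t * (l + conjc c)) =
  conjc r - conjc l * conjc t + conjc t * (conjc l + c).
Proof. by rewrite conjcD conjcD conjcN conjcM conjcM conjcD conjcK. Qed.

Let sum_delta (k : 'I_n) (F : 'I_n -> C) : \sum_(i < n) (i == k)%:R * F i = F k.
Proof.
rewrite (bigD1 k) //= eqxx mul1r big1 ?addr0 // => i /negbTE ->.
by rewrite mul0r.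
Qed.

Lemma reflection_metric x k l : B x ->
  \sum_(i < n) \sum_(j < n) ((i == j)%:R - zcoord x i * conjc (zcoord x j)) *
     (dz i (fun w => zcoord (reflection w) k) x *
      conjc (dz j (fun w => zcoord (reflection w) l) x)) =
  (Den x * conjc (Den x))^-1 * ((k == l)%:R -
     zcoord (reflection x) k * conjc (zcoord (reflection x) l)).
Proof.
move=> Bx; rewrite !reflectionE !zcoord_reflection.
have D0 : Den x * conjc (Den x) != 0 by rewrite gt_eqF // Den_gt0.
apply: (mulfI D0); rewrite mulVKf // mulr_sumr.
(* [u] is the Jacobian with its denominator cleared. The sum then splits into a product of [u] with
   its adjoint, minus a product of two single sums coming from [u] applied to [x]. *)
pose u k i : C := (i == k)%:R + T k x * conjc (p i).
have uE k' i : Den x * dz i (rho k') x = u k' i by rewrite mulrC dz_rhoDen.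
transitivity (\sum_(i < n) \sum_(j < n)
   ((i == j)%:R * (u k i * conjc (u l j)) -
    (u k i * zcoord x i) * conjc (u l j * zcoord x j))).
  apply: eq_bigr => i _; rewrite mulr_sumr; apply: eq_bigr => j _.
  rewrite -!uE !conjcM; exact: metric_term.
under eq_bigr do rewrite sumrB.
rewrite sumrB.
have -> : \sum_(i < n) \sum_(j < n) (i == j)%:R * (u k i * conjc (u l j)) =
   \sum_(i < n) u k i * conjc (u l i).
  apply: eq_bigr => i _; rewrite -[RHS](sum_delta i (fun j => u k i * conjc (u l j))).
  by apply: eq_bigr => j _; rewrite eq_sym.
have sux k' : \sum_(i < n) u k' i * zcoord x i =
    rho k' x - L x * T k' x + T k' x * (L x + conjc b).
  (* The coordinate of [x] is recovered by solving [rho * Den = Num] for it. *)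
  have -> : rho k' x - L x * T k' x = zcoord x k'.
    have := rhoDen k' Bx; rewrite /Num => /eqP; rewrite eq_sym subr_eq => /eqP ->.
    exact/esym/fixed_part_identity.
  rewrite -sumzp mulr_sumr -(sum_delta k' (fun i => zcoord x i)) -big_split /=.
  by apply: eq_bigr => i _; rewrite /u mulrDl -mulrA [conjc _ * _]mulrC.
under [X in _ - X]eq_bigr do rewrite -mulr_sumr -conjc_sum sux.
rewrite -mulr_suml sux.
have -> : \sum_(i < n) u k i * conjc (u l i) =
  (k == l)%:R + conjc (T l x) * p k + T k x * conjc (p l)
    + T k x * conjc (T l x) * P.
  rewrite /P mulr_sumr -(sum_delta k (fun i => (i == l)%:R)).
  rewrite -(sum_delta k p) -(sum_delta l (fun i => conjc (p i))) !mulr_sumr.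
  rewrite -!big_split /=; apply: eq_bigr => i _.
  by rewrite /u conjcD conjcM conjcK conjc_nat product_identity.
have cT : conjc (T l x) = - (conjc kap * (conjc (p l) - conjc b * conjc (rho l x))).
  by rewrite /T conjcN conjcM conjcD conjcN conjcM.
have -> : conjc (rho l x - L x * T l x + T l x * (L x + conjc b)) =
    conjc (rho l x) - conjc (L x) * conjc (T l x) + conjc (T l x) * (conjc (L x) + b).
  exact: conjc_alg.
rewrite cT; exact: (metric_identity _ _ _ _ _ _ _ kapP).
Qed.

(** [L z = 0] says that [(1, z)] is orthogonal to the reflection vector [(b, p)]. *)
Lemma reflection_fixed z : L z = 0 -> reflection z = z.
Proof.
move=> Lz; have rz k : rho k z = zcoord z k.
  by rewrite /rho /Num /Den Lz !mulr0 mul0r !subr0 divr1.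
case: z Lz rz => a c Lz rz; congr (_, _); apply/rowP => k;
  by rewrite !mxE rz.
Qed.

(** At such a fixed point [Den z] is 1 and [rho k z] is the coordinate of [z], so the Jacobian
    reduces to the identity plus its rank-one part. *)
Lemma cderive_reflection z v k : B z -> L z = 0 ->
  cderive v (fun w => zcoord (reflection w) k) z =
  zcoord v k - kap * (p k - b * zcoord z k) * \sum_(i < n) zcoord v i * conjc (p i).
Proof.
move=> Bz Lz; rewrite reflectionE cderive_dz; last exact: cdiff_rho.
have rz : rho k z = zcoord z k.
  by rewrite /rho /Num /Den Lz !mulr0 mul0r !subr0 divr1.
have D1 : Den z = 1 by rewrite /Den Lz mulr0 subr0.
rewrite mulr_sumr -sumrN -[X in _ = X + _](sum_delta k (fun i => zcoord v i)).
rewrite -big_split.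
apply: eq_bigr => i _; rewrite dzbar_rho // mul0r addr0.
have := dz_rhoDen i k Bz; rewrite D1 mulr1 => ->.
rewrite /T rz mulrDl; congr (_ + _).
by rewrite !mulNr -!mulrA [conjc _ * _]mulrC.
Qed.

Lemma invariant_harmonic_reflection (h : E -> R) :
  bounded_inv_harmonic h -> bounded_inv_harmonic (h \o reflection).
Proof.
move=> [hh h1]; split; last by move=> x Bx; apply/h1/reflection_ball.
apply: (invariant_harmonic_comp reflection_ball reflection_smooth reflection_hol
  reflection_hol2 (lambda := fun x => (Den x * conjc (Den x))^-1) _ hh).
exact: reflection_metric.
Qed.

End Reflection.

(** * Sharp constants *)

Section Hermitian.
Variables (R : realType) (n : nat).
Notation E := (Cn R n).
Notation C := R[i].
Implicit Types (x y z : E) (c : R).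

Definition herm x y : C := \sum_(i < n) zcoord x i * conjc (zcoord y i).

Lemma zcoordB x y i : zcoord (x - y) i = zcoord x i - zcoord y i.
Proof. by apply: complex_ext; rewrite /zcoord /= !mxE. Qed.

Lemma zcoordZ c x i : zcoord (c *: x) i = c%:C * zcoord x i.
Proof. by apply: complex_ext; rewrite ?ReZ ?ImZ /zcoord /= !mxE. Qed.

Lemma zcoord0 i : zcoord (0 : E) i = 0.
Proof. by apply: complex_ext; rewrite /zcoord /= !mxE. Qed.

Lemma zcoord_inj x y : (forall i, zcoord x i = zcoord y i) -> x = y.
Proof.
case: x y => [a b] [c d] h; congr (_, _); apply/rowP => i; have := h i;
  by rewrite /zcoord /= => -[].
Qed.

Lemma hermBl x y z : herm (x - y) z = herm x z - herm y z.
Proof.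
by rewrite /herm -sumrB; apply: eq_bigr => i _; rewrite zcoordB mulrBl.
Qed.

Lemma hermJ x y : conjc (herm x y) = herm y x.
Proof.
by rewrite conjc_sum; apply: eq_bigr => i _; rewrite conjcM conjcK mulrC.
Qed.

Lemma hermBr x y z : herm x (y - z) = herm x y - herm x z.
Proof. by rewrite -hermJ hermBl conjcD conjcN !hermJ. Qed.

Lemma hermZl c x y : herm (c *: x) y = c%:C * herm x y.
Proof.
by rewrite /herm mulr_sumr; apply: eq_bigr => i _; rewrite zcoordZ mulrA.
Qed.

Lemma hermZr c x y : herm x (c *: y) = c%:C * herm x y.
Proof. by rewrite -hermJ hermZl conjcM conjc_real hermJ. Qed.

Lemma herm_ge0 x : 0 <= herm x x.
Proof. by apply: sumr_ge0 => i _; exact: mulcJ_ge0. Qed.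

Lemma rdotE x y : rdot x y = complex.Re (herm x y).
Proof.
rewrite /herm Re_sum; apply: eq_bigr => i _.
by rewrite ReM ReJ ImJ mulrN opprK.
Qed.

Lemma hermxx x : herm x x = (rdot x x)%:C.
Proof. by rewrite rdotC_sum. Qed.

Lemma rdot_ge0 x : 0 <= rdot x x.
Proof. by rewrite -lecR -hermxx herm_ge0. Qed.

Lemma enorm_sqr x : enorm x ^+ 2 = rdot x x.
Proof. by rewrite sqr_sqrtr // rdot_ge0. Qed.

Lemma herm_eq0 x : herm x x = 0 -> x = 0.
Proof.
move=> /eqP; rewrite psumr_eq0 => [|i _]; last exact: mulcJ_ge0.
move=> /allP h; apply: zcoord_inj => i.
have zi : zcoord x i = 0.
  have : zcoord x i * conjc (zcoord x i) == 0 := h i (mem_index_enum i).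
  rewrite mulf_eq0 => /orP[/eqP //|/eqP e].
  by rewrite -[zcoord x i]conjcK e conjc0.
by rewrite zi zcoord0.
Qed.

Lemma herm_gt0 x : x <> 0 -> 0 < herm x x.
Proof.
move=> x0; rewrite lt_def herm_ge0 andbT; apply/eqP => /herm_eq0; exact: x0.
Qed.

Let expand_alg (K : comRingType) (A A' H H' x x' y y' : K) :
  (A * x - H * y) * (A' * x' - H' * y') =
  A * A' * (x * x') - A * H' * (x * y') - H * A' * (y * x') + H * H' * (y * y').
Proof. ring. Qed.
Let cs_alg (K : comRingType) (a xy yx b : K) :
  a * a * b - a * yx * xy - xy * a * yx + xy * yx * a = a * (a * b - xy * yx).
Proof. ring. Qed.

Lemma herm_CauchySchwarz x y :
  herm x y * conjc (herm x y) <= herm x x * herm y y.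
Proof.
have [->|/eqP y0] := eqVneq y 0.
  have -> : herm x 0 = 0.
    rewrite /herm big1 // => i _.
    by rewrite zcoord0 conjc0 mulr0.
  by rewrite mul0r mulr_ge0 ?herm_ge0.
have yy0 := herm_gt0 y0.
(* [F] is a multiple of the component of [x] orthogonal to [y]; its squared norm is [herm y y] times
   the Cauchy-Schwarz defect. *)
pose F i : C := herm y y * zcoord x i - herm x y * zcoord y i.
have : 0 <= \sum_(i < n) F i * conjc (F i).
  by apply: sumr_ge0 => i _; exact: mulcJ_ge0.
have -> : \sum_(i < n) F i * conjc (F i) =
    herm y y * (herm y y * herm x x - herm x y * herm y x).
  have expand (A A' H H' : C) :
      \sum_(i < n) (A * zcoord x i - H * zcoord y i) *
        (A' * conjc (zcoord x i) - H' * conjc (zcoord y i)) =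
      A * A' * herm x x - A * H' * herm x y - H * A' * herm y x + H * H' * herm y y.
    rewrite /herm !mulr_sumr -!sumrB -big_split /=.
    by apply: eq_bigr => i _; exact: expand_alg.
  rewrite -cs_alg -expand; apply: eq_bigr => i _.
  by rewrite /F conjcD conjcN !conjcM !hermJ.
rewrite pmulr_rge0 // subr_ge0 => h.
by rewrite hermJ [X in _ <= X]mulrC.
Qed.

End Hermitian.

(** * Transitivity on Bergman spheres and the radial maximum *)

Section SharpConstants.
Variables (R : realType) (n : nat).
Notation E := (Cn R n).
Notation C := R[i].
Notation B := (unit_ball : set E).
Implicit Types (x y z l v : E) (h : E -> R).

Lemma enormZ (c : R) x : 0 <= c -> enorm (c *: x) = c * enorm x.
Proof.
move=> c0; rewrite /enorm.
have -> : rdot (c *: x) (c *: x) = c ^+ 2 * rdot x x.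
  by rewrite !rdotE hermZl hermZr !ReZ mulrA -expr2.
by rewrite sqrtrM ?sqr_ge0 // sqrtr_sqr ger0_norm.
Qed.

Lemma rdot_CauchySchwarz x y : `|rdot x y| <= enorm x * enorm y.
Proof.
rewrite -(@ler_pXn2r _ 2) ?nnegrE ?mulr_ge0 ?sqrtr_ge0 //.
rewrite real_normK ?num_real // exprMn !enorm_sqr.
have := herm_CauchySchwarz x y.
rewrite -sqr_normc -add_Re2_Im2 !hermxx -rmorphM lecR; apply: le_trans.
by rewrite rdotE lerDl sqr_ge0.
Qed.

Lemma rdot_grad h z l : differentiable h z -> rdot (grad h z) l = 'D_l h z.
Proof.
move=> dh; rewrite derive_basis //; apply: eq_bigr => j _.
by rewrite /grad /= !mxE; congr (_ + _); exact: mulrC.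
Qed.

(* The Bergman metric at [z], up to the scalar [1 - herm z z]. *)
Definition bergman z x y : C :=
  herm x y + herm x z * conjc (herm y z) / (1 - herm z z).

Let bergman_left (K : fieldType) (v1 v c' s : K) :
  s != 0 -> v1 + c' / s * v = v1 + v * c' / s.
Proof. by move=> s0; field. Qed.

Let bergman_square (K : fieldType) (vv w w' zz : K) : 1 - zz != 0 ->
  vv + w' / (1 - zz) * w + w / (1 - zz) * w' + w / (1 - zz) * (w' / (1 - zz)) * zz
    - w / (1 - zz) * (w' / (1 - zz)) = vv + w * w' / (1 - zz).
Proof. by move=> s0; field. Qed.

Let polarization_alg (V : zmodType) (x y w : V) :
  (x - y) + (x - w) = (x - y) - (w - x).
Proof. by rewrite opprB. Qed.

Let inv_alg (K : fieldType) (c d : K) : c != 0 -> d != 0 ->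
  c^-1 + d^-1 = c^-1 * d^-1 * (c + d).
Proof. by move=> c0 d0; field; rewrite c0 d0. Qed.

Let expand_alg (K : comRingType) (x y z t b b' : K) :
  (x + b * z) * (y + b' * t) = 
    x * y + b' * (x * t) + b * (z * y) + b * b' * (z * t).
Proof. ring. Qed.

(** A quasi-reflection fixing [z], in the lift of [v1 - v2], has a differential at [z] that carries
    [v1] to [v2]; [h'] is [h] composed with it. *)
Lemma exists_ball_map z v1 v2 h : B z ->
  bergman z v1 v1 = bergman z v2 v2 -> bounded_inv_harmonic h ->
  exists2 h', bounded_inv_harmonic h' & 'D_v1 h' z = 'D_v2 h z.
Proof.
move=> Bz b12 Hh.
(* Equal vectors are set apart, as the reflection vector would be zero; [h] itself then serves. *)
have [e|/eqP v0] := eqVneq (v1 - v2) 0.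
  have -> : v1 = v2 by apply/eqP; rewrite -subr_eq0 e.
  by exists h.
set v := v1 - v2 in v0.
have s_gt0 : 0 < 1 - herm z z.
  by rewrite hermxx subr_gt0 -[1]/(1%:C) ltcR -enorm_lt1.
have s0 : 1 - herm z z != 0 by rewrite gt_eqF.
have sJ : conjc (1 - herm z z) = 1 - herm z z.
  by rewrite conjcD conjcN conjc1 hermJ.
(* [(b, p)] is [(0, v)] plus [b] times [(1, z)], with [b] chosen to make it orthogonal to [(1, z)].
   On such lifts the form of signature (n, 1) is [bergman z]. *)
pose b : C := herm v z / (1 - herm z z).
have bJ : conjc b = herm z v / (1 - herm z z).
  by rewrite /b conjcM conjc_inv sJ hermJ.
pose p i : C := zcoord v i + b * zcoord z i.
have hp x : \sum_(i < n) zcoord x i * conjc (p i) = herm x v + conjc b * herm x z.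
  rewrite /herm mulr_sumr -big_split /=; apply: eq_bigr => i _.
  by rewrite /p conjcD conjcM mulrDr mulrCA.
have aE x : \sum_(i < n) zcoord x i * conjc (p i) = bergman z x v.
  by rewrite hp bJ -(hermJ v z) bergman_left.
pose a : C := bergman z v1 v.
have PE : \sum_(i < n) p i * conjc (p i) - b * conjc b = bergman z v v.
  have -> : \sum_(i < n) p i * conjc (p i) =
     herm v v + conjc b * herm v z + b * herm z v + b * conjc b * herm z z.
    rewrite /herm !mulr_sumr -!big_split /=; apply: eq_bigr => i _.
    by rewrite /p conjcD conjcM expand_alg.
  by rewrite bJ /b bergman_square // /bergman hermJ.
have bJ12 x y : conjc (bergman z x y) = bergman z y x.
  by rewrite /bergman conjcD !conjcM conjc_inv sJ !hermJ [herm z x * _]mulrC.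
have bBr x y y' : bergman z x (y - y') = bergman z x y - bergman z x y'.
  rewrite /bergman hermBr hermBl conjcD conjcN mulrBr mulrBl.
  by rewrite opprD addrACA.
have bBl x x' y : bergman z (x - x') y = bergman z x y - bergman z x' y.
  by rewrite -bJ12 bBr conjcD conjcN !bJ12.
(* Equality of the Bergman lengths enters here: twice the real part of <v1, v1 - v2> is the squared
   length of v1 - v2. This gives [kapP] for [kap] equal to 1/a, and positivity of that length gives
   [a != 0]. *)
have aD : a + conjc a = bergman z v v.
  by rewrite /a bJ12 /v bBr !bBl !bBr -b12; exact: polarization_alg.
have bvv_gt0 : 0 < bergman z v v.
  by rewrite ltr_pwDl ?herm_gt0 // divr_ge0 ?mulcJ_ge0 // ltW.
have a0 : a != 0.
  by apply: contraTneq bvv_gt0 => e; rewrite -aD e conjc0 addr0 ltxx.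
have kapP : a^-1 + conjc a^-1 =
    a^-1 * conjc a^-1 * (\sum_(i < n) p i * conjc (p i) - b * conjc b).
  have aJ0 : conjc a != 0 by rewrite conjc_eq0.
  by rewrite PE -aD conjc_inv inv_alg.
have Lz : \sum_(i < n) zcoord z i * conjc (p i) - conjc b = 0.
  rewrite hp bJ; apply/eqP; rewrite subr_eq0; apply/eqP.
  apply: (mulIf s0); rewrite mulrDl divfK // mulrAC divfK //.
  by rewrite mulrBr mulr1 subrK.
exists (h \o reflection p b a^-1); first exact: invariant_harmonic_reflection.
have fix_z : reflection p b a^-1 z = z by exact: reflection_fixed.
have [[[dh _] _] _] := Hh.
pose G (w : E) : C := (h w)%:C.
have dG : cdiff G z by split; [exact: dh|exact: differentiable_cst].
have dr k : cdiff (fun w => zcoord (reflection p b a^-1 w) k) z.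
  exact: (cclass_cdiff (reflection_smooth kapP 1 k)).
(* The real derivatives are the real parts of these complex ones, since [G] is [h] viewed as
   complex-valued. *)
suff : cderive v1 (G \o reflection p b a^-1) z = cderive v2 G z by case.
rewrite (cderive_comp v1 dr) fix_z // cderive_dz //; apply: eq_bigr => k _.
have -> : cderive v1 (fun w => zcoord (reflection p b a^-1 w) k) z = zcoord v2 k.
  (* Since p - bz = v and the pairing of [v1] with [p] is [a], the factor 1/a leaves v1 - v = v2. *)
  rewrite cderive_reflection // aE -/a /p addrK mulrAC mulVf // mul1r.
  by rewrite /v zcoordB subKr.
by [].
Qed.

(** The radial unit vector has the largest Bergman length among Euclidean unit vectors. Hence [l]
    reaches that length after stretching by some c >= 1, which can only increase the derivative of
    [h]. *)
Lemma derive_radial_max z l h : B z -> z <> 0 -> enorm l = 1 ->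
  bounded_inv_harmonic h -> exists2 h', bounded_inv_harmonic h' &
  `|rdot (grad h z) l| <= `|rdot (grad h' z) ((enorm z)^-1 *: z)|.
Proof.
move=> Bz z0 l1 Hh.
have r0 : rdot z z != 0.
  by have := herm_gt0 z0; rewrite hermxx -[0]/(0%:C) ltcR => /gt_eqF ->.
have r_gt0 : 0 < rdot z z by rewrite lt_def r0 rdot_ge0.
have e0 : enorm z != 0 by rewrite -sqrf_eq0 enorm_sqr.
have s_gt0 : 0 < 1 - rdot z z by rewrite subr_gt0 -enorm_lt1.
pose N := complex.Re (herm l z) ^+ 2 + complex.Im (herm l z) ^+ 2.
have NE : herm l z * conjc (herm l z) = N%:C by rewrite -sqr_normc add_Re2_Im2.
have N0 : 0 <= N by rewrite addr_ge0 ?sqr_ge0.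
have l11 : rdot l l = 1 by rewrite -enorm_sqr l1 expr1n.
have NC : N <= rdot z z.
  by rewrite -lecR -NE; have := herm_CauchySchwarz l z; rewrite !hermxx l11 mul1r.
(* [ql] and [q1] are the squared Bergman lengths of [l] and of the radial unit vector;
   Cauchy-Schwarz, in the form [NC], compares them. *)
pose ql := 1 + N / (1 - rdot z z); pose q1 := (1 - rdot z z)^-1.
have ql_gt0 : 0 < ql by rewrite ltr_pwDl // divr_ge0 // ltW.
have qle : ql <= q1.
  rewrite -(ler_pM2r s_gt0) /ql /q1 mulVf ?gt_eqF // mulrDl divfK ?gt_eqF // mul1r.
  by rewrite addrAC lerBlDr lerD2l.
pose c := Num.sqrt (q1 / ql).
have c1 : 1 <= c by rewrite -[1]sqrtr1 ler_wsqrtr // ler_pdivlMr // mul1r.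
have c0 : 0 <= c by apply: le_trans c1.
have c2 : c ^+ 2 * ql = q1.
  by rewrite sqr_sqrtr ?divfK ?gt_eqF // divr_ge0 ?invr_ge0 ?ltW.
pose v1 : E := (enorm z)^-1 *: z.
have sC : 1 - herm z z = (1 - rdot z z)%:C by rewrite hermxx rmorphB rmorph1.
have B1 : bergman z v1 v1 = q1%:C.
  rewrite /bergman sC /v1 !hermZl !hermZr conjcM conjc_real hermJ hermxx.
  rewrite -!rmorphM -fmorphV -!rmorphM -rmorphD /=; congr (_%:C).
  rewrite -enorm_sqr /q1 -enorm_sqr.
  have s0 : 1 - enorm z ^+ 2 != 0 by rewrite enorm_sqr gt_eqF.
  by field; rewrite s0 e0.
have B2 : bergman z (c *: l) (c *: l) = q1%:C.
  rewrite /bergman sC !hermZl !hermZr conjcM conjc_real mulrACA NE hermxx l11.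
  rewrite -!rmorphM -fmorphV -!rmorphM -rmorphD /=; congr (_%:C).
  have s0 : 1 - rdot z z != 0 by rewrite gt_eqF.
  by rewrite -c2 /ql; field.
(* The radial derivative of [h'] equals the derivative of [h] along [c *: l], that is [c] times the
   one along [l]. *)
have [h' Hh' D'] := exists_ball_map Bz (etrans B1 (esym B2)) Hh.
exists h' => //.
have [[[dh _] _] _] := Hh; have [[[dh' _] _] _] := Hh'.
rewrite -/v1 !rdot_grad; [|exact: dh'|exact: dh].
rewrite D' !deriveE; [|exact: dh|exact: dh].
by rewrite linearZ /= normrZ ger0_norm // ler_peMl.
Qed.

End SharpConstants.

(** * Comparison of the three suprema *)

Theorem mainTheorem2 (R : realType) (n : nat) (hn : (1 <= n)%N) (z : Cn R n)
    (hz : unit_ball z) (hz0 : z <> 0) :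
  ereal_sup [set sharp_dir z l | l in unit_sphere]
    = sharp_dir z ((enorm z)^-1 *: z)
  /\ sharp_dir z ((enorm z)^-1 *: z) = sharp_grad z.
Proof.
have r_gt0 : 0 < enorm z.
  rewrite sqrtr_gt0 -ltcR -hermxx; exact: herm_gt0.
have v1S : unit_sphere ((enorm z)^-1 *: z).
  by rewrite /unit_sphere /= enormZ ?invr_ge0 ?ltW // mulVf // gt_eqF.
have le_radial l h : unit_sphere l -> bounded_inv_harmonic h ->
    (`|rdot (grad h z) l|%:E <= sharp_dir z ((enorm z)^-1 *: z))%E.
  move=> l1 Hh; have [h' Hh' le] := derive_radial_max hz hz0 l1 Hh.
  apply: (@le_trans _ _ (`|rdot (grad h' z) ((enorm z)^-1 *: z)|%:E)).
    by rewrite lee_fin.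
  by apply: ereal_sup_ubound; exists h'.
split; apply/eqP; rewrite eq_le; apply/andP; split.
- apply: ge_ereal_sup => _ [l l1 <-]; apply: ge_ereal_sup => _ [h Hh <-].
  exact: le_radial.
- by apply: ereal_sup_ubound; exists ((enorm z)^-1 *: z).
- apply: ge_ereal_sup => _ [h Hh <-].
  apply: (@le_trans _ _ (enorm (grad h z))%:E).
    by rewrite lee_fin (le_trans (rdot_CauchySchwarz _ _)) // v1S mulr1.
  by apply: ereal_sup_ubound; exists h.
apply: ge_ereal_sup => _ [h Hh <-].
(* A zero gradient cannot be normalised; its norm 0 is bounded by any admissible value. *)
have [g0|/eqP g0] := eqVneq (grad h z) 0.
  apply: (le_trans _ (le_radial _ h v1S Hh)); rewrite lee_fin.
  have h0 : herm (0 : Cn R n) 0 = 0.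
    by rewrite /herm big1 // => i _; rewrite zcoord0 mul0r.
  by rewrite g0 /enorm rdotE h0 sqrtr0.
have g_gt0 : 0 < enorm (grad h z).
  rewrite sqrtr_gt0 -ltcR -hermxx; exact: herm_gt0.
(* The direction of the gradient is tested, since the derivative along it is the full norm of the
   gradient. *)
have gS : unit_sphere ((enorm (grad h z))^-1 *: grad h z).
  by rewrite /unit_sphere /= enormZ ?invr_ge0 ?ltW // mulVf // gt_eqF.
apply: (le_trans _ (le_radial _ h gS Hh)); rewrite lee_fin.
rewrite rdotE hermZr ReZ -rdotE -enorm_sqr expr2 mulKf ?gt_eqF //.
exact: ler_norm.
Qed.
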